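(* For every graph $H$ with at least one edge and every $\eta>0$ there exists an integer $n_0=n_0(H,\eta)$ such that if $n\ge n_0$ then $$\left(1-\frac{1}{\chi(H)-1}\right)n-1\;\le\;\delta'(H,n)\;\le\;\left(1-\frac{1}{\chi(H)-1}+\eta\right)n .$$
   Context: All graphs are finite and simple; $\delta(G)$ is the minimum degree of $G$, and copies of $H$ are not necessarily induced subgraphs. $\delta'(H,n)$ denotes the smallest integer $k$ such that whenever $w$ is a vertex of a graph $G$ of order $n$ with $\delta(G)\ge k$, then $G$ contains a copy of $H$ covering $w$. *)

(* Defs.v *)
From HB Require Import structures.
From mathcomp Require Import all_boot all_order all_algebra.
From mathcomp Require Import boolp reals.

Set Implicit Arguments.
Unset Strict Implicit.
Unset Printing Implicit Defensive.

Import Order.TTheory.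

Record sgraph := SGraph {
  vertex :> finType;
  adj : rel vertex;
  adj_sym : symmetric adj;
  adj_irrefl : irreflexive adj
}.

Definition has_edge (G : sgraph) : Prop := exists x y : G, adj x y.

Definition degree (G : sgraph) (v : G) : nat := #|[set u : G | adj v u]|.

(* The default value #|G| exceeds every degree, so this is the true minimum
   on every graph with a vertex; the graph with no vertex gets 0. *)
Definition min_degree (G : sgraph) : nat :=
  \big[minn/#|G|]_(v : G) degree v.

Definition colorable (G : sgraph) (k : nat) : bool :=
  [exists f : {ffun G -> 'I_k},
    [forall x : G, forall y : G, adj x y ==> (f x != f y)]].

Lemma colorable_ex (G : sgraph) : exists k, colorable G k.
Proof.
exists #|G|; apply/existsP; exists [ffun x => enum_rank x].
apply/forallP => x; apply/forallP => y; apply/implyP => xy.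
rewrite !ffunE (inj_eq enum_rank_inj).
by apply: contraL xy => /eqP ->; rewrite adj_irrefl.
Qed.

Definition chromatic_number (G : sgraph) : nat := ex_minn (colorable_ex G).

(* Copies are subgraphs, not necessarily induced: non-edges of H may be sent
   to edges of G. *)
Definition has_copy_covering (H G : sgraph) (w : G) : Prop :=
  exists f : H -> G,
    [/\ injective f,
        forall x y : H, adj x y -> adj (f x) (f y) &
        exists x : H, f x = w].

Definition cover_forcing (H : sgraph) (n k : nat) : Prop :=
  forall (G : sgraph) (w : G),
    #|G| = n -> k <= min_degree G -> has_copy_covering H w.

(* k = n forces a cover vacuously: a graph of order n has no vertex of
   degree n. *)
Lemma cover_forcing_ex (H : sgraph) (n : nat) :
  exists k, `[< cover_forcing H n k >].
Proof.
exists n; apply/asboolP => G w cardG; rewrite leqNgt => /negP[].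
have wdeg : degree w < n.
  rewrite -cardG -cardsT; apply: proper_card; apply/properP.
  by split; [exact: subsetT | exists w; rewrite ?inE // adj_irrefl].
apply: leq_ltn_trans wdeg; rewrite -leEnat /min_degree -minEnat.
exact: bigmin_le.
Qed.

(* The minimum is over natural numbers. If H has an edge and n > 0, then 0 is
   not forcing (take the edgeless graph of order n), so this is also the least
   integer with the property. *)
Definition delta' (H : sgraph) (n : nat) : nat :=
  ex_minn (cover_forcing_ex H n).

(* Main.v *)
(** Let s + 1 be the chromatic number of H.

    Lower bound: the Turan graph with s parts on n vertices has minimum degree
    at least n - n/s - 1, and every subgraph of it is s-colourable.

    Upper bound: if the minimum degree is at least (1 - 1/s + eta) n, then any s
    vertices have at least eta n common neighbours, and any s - 1 vertices have
    at least eta n common neighbours inside the neighbourhood of w.  Classes of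
    a complete multipartite graph are therefore built one at a time: each of
    the T disjoint transversals of the current classes has a positive
    proportion of all vertices as common neighbours, so by pigeonhole t
    vertices share t transversals once T and then n are large.  The first s
    classes are taken inside the neighbourhood of w and the last one outside w,
    so that w may be added to the last class. *)

Require Import Defs.
From HB Require Import structures.
From mathcomp Require Import all_boot all_order all_algebra.
From mathcomp Require Import boolp reals.
From mathcomp Require Import perm zify lra.
Import Order.TTheory GRing.Theory Num.Theory.
Local Open Scope ring_scope.

Set Implicit Arguments.
Unset Strict Implicit.

(** * Minimum degree and a pigeonhole count *)

Lemma min_degreeP (G : sgraph) (k : nat) :
  (k <= #|G|)%N -> reflect (forall v : G, (k <= degree v)%N)
                           (k <= min_degree G)%N.
Proof.
move=> kG; rewrite /min_degree -leEnat -minEnat.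
apply: (iffP idP) => [kd v | kd].
  by apply: le_trans kd _; exact: bigmin_le.
by apply/bigmin_geP; split=> // v _; exact: kd.
Qed.

Lemma min_degree_le (G : sgraph) : (min_degree G <= #|G|)%N.
Proof. by rewrite /min_degree -leEnat -minEnat; exact: bigmin_le_id. Qed.

(* With 2qt indices the average of #|S x| is at least 2t, so the x with
   #|S x| < t account for at most half of the total. *)
Lemma shared_subset (V : finType) (q t : nat)
    (S : V -> {set 'I_(2 * q * t)}) :
  (forall i, (#|V| <= q * #|[set x | i \in S x]|)%N) ->
  (0 < t)%N -> (0 < q)%N -> (2 ^ (2 * q * t) * (2 * q * t) < #|V|)%N ->
  exists2 I : {set 'I_(2 * q * t)}, (t <= #|I|)%N &
    (t <= #|[set x | S x == I]|)%N.
Proof.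
set T := (2 * q * t)%N => hS t0 q0 hV.
case: (boolP [exists I : {set 'I_T},
  (t <= #|I|)%N && (t <= #|[set x | S x == I]|)%N]).
  by case/existsP=> I /andP[]; exists I.
rewrite negb_exists => /forallP none.
(* Double counting of the pairs of a vertex [x] and an index in [S x]. *)
have lower : (T * #|V| <= q * \sum_x #|S x|)%N.
  have -> : (\sum_x #|S x| = \sum_(i < T) #|[set x | i \in S x]|)%N.
    rewrite (eq_bigr (fun x => \sum_i (i \in S x : nat))%N) => [|x _].
      rewrite exchange_big /=; apply: eq_bigr => i _.
      rewrite -sum1_card [RHS]big_mkcond; apply: eq_bigr => x _ /=.
      by rewrite inE; case: ifP.
    by rewrite -sum1_card big_mkcond; apply: eq_bigr => i _ /=; case: ifP.
  rewrite big_distrr /= -[T in (T * _)%N]card_ord -sum_nat_const.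
  exact: leq_sum.
(* Small sets contribute less than [t] each. Large ones are grouped by value: at most [2 ^ T]
   values, each taken by fewer than [t] vertices. *)
have upper : (\sum_x #|S x| <= #|V| * t + 2 ^ T * (t * T))%N.
  rewrite (bigID (fun x => (#|S x| < t)%N)) /=; apply: leq_add.
    rewrite -sum_nat_const [leqRHS](bigID (fun x => (#|S x| < t)%N)) /=.
    by apply: leq_trans (leq_addr _ _); apply: leq_sum => x /ltnW.
  rewrite (partition_big S predT) //=.
  have -> : (2 ^ T * (t * T) = \sum_(I : {set 'I_T}) t * T)%N.
    by rewrite sum_nat_const -cardsT -powersetT card_powerset cardsT card_ord.
  apply: leq_sum => I _.
  have := none I; rewrite negb_and -!ltnNge => /orP[It|fib].
    rewrite big1 // => x /andP[big /eqP SI].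
    by rewrite SI It in big.
  apply: (@leq_trans (\sum_(x in [set x | S x == I]) T)%N).
    rewrite big_mkcond [leqRHS]big_mkcond /=; apply: leq_sum => x _.
    rewrite inE; case: (S x == I); rewrite ?andbF // andbT.
    by case: ifP => // _; rewrite -[leqRHS]card_ord max_card.
  by rewrite sum_nat_const leq_mul2r ltnW ?orbT.
have /(leq_trans lower) : (q * \sum_x #|S x| <= q * (#|V| * t + 2 ^ T * (t * T)))%N.
  by rewrite leq_mul2l upper orbT.
rewrite leqNgt => /negP[].
have -> : (T * #|V| = q * (#|V| * t + #|V| * t))%N by rewrite /T; lia.
rewrite ltn_pmul2l // ltn_add2l.
by rewrite (mulnC t) mulnA ltn_pmul2r.
Qed.

(** * Complete multipartite subgraphs *)

(** For fixed [i], the vertices [f a i] form a transversal. Disjointness of the classes follows from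
    adjacency, as no vertex is adjacent to itself. *)
Definition blowup (G : sgraph) (A : nat -> {set G}) (m t : nat)
    (f : nat -> nat -> G) : Prop :=
  [/\ forall a i, (a < m)%N -> (i < t)%N -> f a i \in A a,
      forall a i k, (a < m)%N -> (i < t)%N -> (k < t)%N ->
        f a i = f a k -> i = k &
      forall a b i k, (a < m)%N -> (b < m)%N -> a != b ->
        (i < t)%N -> (k < t)%N -> adj (f a i) (f b k)].

Lemma blowup_step (G : sgraph) (A : nat -> {set G}) (q m t : nat)
    (f : nat -> nat -> G) :
  (0 < t)%N -> (0 < q)%N -> (2 ^ (2 * q * t) * (2 * q * t) < #|G|)%N ->
  (forall v : nat -> G,
    (#|G| <= q * #|[set x in A m | [forall a : 'I_m, adj (v a) x]]|)%N) ->
  blowup A m (2 * q * t) f -> exists g, blowup A m.+1 t g.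
Proof.
set T := (2 * q * t)%N => t0 q0 hG common [fA finj fadj].
pose S (x : G) : {set 'I_T} :=
  [set i : 'I_T | (x \in A m) && [forall a : 'I_m, adj (f a i) x]].
have [i|I It Xt] := @shared_subset G q t S _ t0 q0 hG.
  apply: leq_trans (common (fun a => f a i)) _.
  by rewrite leq_mul2l subset_leq_card ?orbT //; apply/subsetP => x; rewrite !inE.
have /card_gt0P[x0 _] : (0 < #|G|)%N by apply: leq_trans hG.
(* The new class [y] lists vertices sharing the set [I] of transversals; [e] selects [t] of these,
   which cuts the old classes down to size [t]. *)
pose e i := nth 0%N [seq val x | x <- enum I] i.
pose X := [set x | S x == I]; pose y i := nth x0 (enum X) i.
have eI i : (i < t)%N -> exists2 j : 'I_T, j \in I & e i = j.
  move=> it; have iI : (i < size (enum I))%N.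
    by rewrite -cardE; apply: leq_trans It.
  have /mapP[j jI ->] : e i \in [seq val x | x <- enum I].
    by rewrite mem_nth ?size_map.
  by exists j => //; rewrite -mem_enum.
have eT i : (i < t)%N -> (e i < T)%N by move=> /eI[j _ ->].
have yX i : (i < t)%N -> y i \in X.
  move=> it; rewrite -mem_enum mem_nth // -cardE.
  exact: leq_trans Xt.
have yA i : (i < t)%N -> y i \in A m.
  move=> it; have := yX _ it; rewrite inE => /eqP SI.
  by have [j] := eI _ it; rewrite -SI inE => /andP[].
have yadj a i k : (a < m)%N -> (i < t)%N -> (k < t)%N -> adj (f a (e i)) (y k).
  move=> am it kt; have := yX _ kt; rewrite inE => /eqP SI.
  have [j + ->] := eI _ it.
  by rewrite -SI inE => /andP[_ /forallP /(_ (Ordinal am))].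
have mE a : (a < m.+1)%N -> (a < m)%N \/ a = m by lia.
exists (fun a i => if (a < m)%N then f a (e i) else y i); split.
- move=> a i /mE[am|->] it; rewrite ?am ?ltnn; last exact: yA.
  exact/fA/eT.
- move=> a i k /mE[am|->] it kt; rewrite ?am ?ltnn.
    move=> /(finj _ _ _ am (eT _ it) (eT _ kt)) /eqP.
    rewrite nth_uniq ?size_map -?cardE ?(leq_trans _ It) //; first by move/eqP.
    by rewrite map_inj_uniq ?enum_uniq //; exact: val_inj.
  move/eqP; rewrite nth_uniq -?cardE ?enum_uniq ?(leq_trans _ Xt) //.
  by move/eqP.
- move=> a b i k /mE[am|->] /mE[bm|->] ab it kt; rewrite ?am ?bm ?ltnn.
  + by apply: fadj => //; exact: eT.
  + exact: yadj.
  + by rewrite adj_sym; exact: yadj.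
  + by rewrite eqxx in ab.
Qed.

(** Induction on [m] for all [t] at once: adding a class of size [t] uses up earlier classes of size
    [2 * q * t]. *)
Lemma blowup_ex (q m t : nat) : (0 < t)%N -> (0 < q)%N ->
  exists n0 : nat, forall (G : sgraph) (A : nat -> {set G}),
    (n0 <= #|G|)%N ->
    (forall j, (j < m)%N -> forall v : nat -> G,
      (#|G| <= q * #|[set x in A j | [forall a : 'I_j, adj (v a) x]]|)%N) ->
    exists f, blowup A m t f.
Proof.
move=> t0 q0; elim: m t t0 => [|m IH] t t0.
  exists 1%N => G A /card_gt0P[x0 _] _.
  by exists (fun _ _ => x0); split.
have [|n0 h] := IH (2 * q * t)%N; first by rewrite !muln_gt0 q0.
exists (n0 + (2 ^ (2 * q * t) * (2 * q * t)).+1)%N => G A hn common.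
have [|j jm|f ff] := h G A; first lia.
  by apply: common; lia.
by apply: blowup_step ff => //; [lia | exact: common].
Qed.

(** * Common neighbourhoods and the upper bound *)

(** Each vertex has at most [d] non-neighbours, itself included, so each of the [j] adjacency
    constraints removes at most [d] elements of [B]. *)
Lemma card_common_neighbours (G : sgraph) (B : {set G}) (d j : nat)
    (v : nat -> G) :
  (forall u : G, (#|G| <= degree u + d)%N) ->
  (#|B| <= #|[set x in B | [forall a : 'I_j, adj (v a) x]]| + j * d)%N.
Proof.
move=> hd; elim: j => [|j IH].
  rewrite addn0 subset_leq_card //; apply/subsetP => x xB; rewrite inE xB /=.
  by apply/forallP => -[].
apply: leq_trans IH _; rewrite mulSn addnA leq_add2r.
set C := [set x in B | _]; pose N := [set x | adj (v j) x].
rewrite -(cardsID N C); apply: leq_add.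
  apply: subset_leq_card; apply/subsetP => x; rewrite !inE.
  case/andP=> /andP[-> /forallP h] vx; apply/forallP => a /=.
  have [aj|aj] := ltnP a j; first exact: (h (Ordinal aj)).
  by have -> : a = j :> nat by have := ltn_ord a; lia.
have := hd (v j); rewrite -(cardC N) /degree leq_add2l => /(leq_trans _); apply.
by rewrite subset_leq_card //; apply/subsetP => x; rewrite !inE => /andP[].
Qed.

(** The degree condition says that [n - s * (n - k)] is at least [2 * n / q]: one share [n / q]
    feeds [blowup_ex], the other pays for excluding [w], since [q <= n]. *)
Lemma cover_forcing_large (H : sgraph) (x0 : H) (s q : nat) :
  (0 < q)%N -> colorable H s.+1 ->
  exists n0 : nat, forall n k : nat, (n0 <= n)%N ->
    (q * (s * (n - k)) + 2 * n <= q * n)%N -> cover_forcing H n k.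
Proof.
move=> q0 /existsP[c /forallP hc].
have H0 : (0 < #|H|)%N by apply/card_gt0P; exists x0.
have [n0 hn0] := @blowup_ex q s.+1 #|H| H0 q0.
exists (n0 + q)%N => n k hn hk G w Gn kG.
have hdeg (u : G) : (#|G| <= degree u + (n - k))%N.
  have kn : (k <= #|G|)%N by apply: leq_trans kG (min_degree_le G).
  by have /min_degreeP/(_ u) := kG; lia.
pose A a := if (a < s)%N then [set u : G | adj w u] else [set~ w].
have [||f [fA finj fadj]] := hn0 G A; first lia.
  move=> j js v; have := @card_common_neighbours G (A j) (n - k) j v hdeg.
  set C := [set x in A j | _] => hC.
  (* For [j < s], [w] counts as one more vertex, giving at most [s] constraints; for [j = s], only
     [w] itself is lost. *)
  have : (n <= #|C| + s * (n - k) + 1)%N.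
    move: hC; rewrite {1}/A; case: ltnP => sj.
      have : (j.+1 * (n - k) <= s * (n - k))%N by rewrite leq_mul2r sj orbT.
      by have := hdeg w; rewrite /degree mulSn Gn; lia.
    have -> : j = s by lia.
    by rewrite cardsC1; lia.
  by rewrite Gn; nia.
(* Colours are swapped so that [x0] gets the last one; its neighbours then land in classes inside
   the neighbourhood of [w]. *)
pose p : {perm 'I_s.+1} := tperm (c x0) ord_max.
pose F (x : H) := f (p (c x)) (enum_rank x).
have FA x : F x \in A (p (c x)) by apply: fA.
have Fw x : F x != w.
  have := FA x; rewrite /A; case: ifP => _; last by rewrite !inE.
  by rewrite inE; apply: contraTneq => ->; rewrite adj_irrefl.
have wF x : adj x0 x -> adj w (F x).
  move=> xx; have cx : c x0 != c x by have /forallP/(_ x)/implyP := hc x0; apply.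
  have := FA x; rewrite /A; have -> : (p (c x) < s)%N; last by rewrite inE.
  have : p (c x) != ord_max.
    by rewrite -(tpermL (c x0) ord_max) (inj_eq perm_inj) eq_sym.
  by rewrite -val_eqE /= => ne; rewrite ltn_neqAle ne -ltnS ltn_ord.
have FF x y : adj x y -> adj (F x) (F y).
  move=> xy; apply: fadj => //.
  rewrite val_eqE (inj_eq perm_inj).
  by have /forallP/(_ y)/implyP := hc x; apply.
have Finj : injective F.
  move=> x y Fxy; have [pxy|pxy] := eqVneq (p (c x)) (p (c y)).
    apply/enum_rank_inj/val_inj.
    apply: (finj (p (c x)) _ _ (ltn_ord _) (ltn_ord _) (ltn_ord _)).
    by move: Fxy; rewrite /F -pxy.
  have := fadj _ _ _ _ (ltn_ord (p (c x))) (ltn_ord (p (c y))) pxy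
    (ltn_ord (enum_rank x)) (ltn_ord (enum_rank y)).
  by rewrite -/(F x) -/(F y) Fxy adj_irrefl.
exists (fun x => if x == x0 then w else F x); split.
- move=> x y; case: eqP => [->|_]; case: eqP => [->|_] //.
  + by move=> /eqP; rewrite eq_sym (negbTE (Fw _)).
  + by move=> /eqP; rewrite (negbTE (Fw _)).
  + exact: Finj.
- move=> x y; case: eqP => [->|_]; case: eqP => [->|_].
  + by rewrite adj_irrefl.
  + exact: wF.
  + by rewrite adj_sym => xx; rewrite adj_sym; exact: wF.
  + exact: FF.
- by exists x0; rewrite eqxx.
Qed.

(** * Turan graphs and the lower bound *)

Definition turan_adj (n s : nat) : rel 'I_n := fun i j => i != j %[mod s].

Lemma turan_adj_sym (n s : nat) : symmetric (@turan_adj n s).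
Proof. by move=> i j; rewrite /turan_adj eq_sym. Qed.

Lemma turan_adj_irrefl (n s : nat) : irreflexive (@turan_adj n s).
Proof. by move=> i; rewrite /turan_adj eqxx. Qed.

Definition turan (n s : nat) : sgraph :=
  SGraph (@turan_adj_sym n s) (@turan_adj_irrefl n s).

(** Non-neighbours of [v] share its residue mod [s], so they are told apart by their quotients,
    which are at most [n %/ s]. *)
Lemma turan_degree (n s : nat) (v : turan n s) :
  (n <= degree v + (n %/ s).+1)%N.
Proof.
have := cardC [set u | adj v u]; rewrite card_ord /degree /= => {1}<-.
rewrite leq_add2l.
pose g (u : 'I_n) : 'I_(n %/ s).+1 := inord (u %/ s).
have gE (u : 'I_n) : g u = (u %/ s)%N :> nat.
  by rewrite inordK // ltnS leq_div2r // ltnW.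
rewrite -[leqRHS]card_ord -(@card_in_image _ _ g) ?max_card // => u u'.
rewrite !inE /turan_adj !negbK => /eqP vu /eqP vu' /(congr1 val) /=.
rewrite !gE => e.
by apply: val_inj; rewrite /= (divn_eq u s) (divn_eq u' s) e -vu -vu'.
Qed.

Lemma turan_copy_colorable (H : sgraph) (n s : nat) (w : turan n s) :
  (0 < s)%N -> has_copy_covering H w -> colorable H s.
Proof.
case: s w => // s w _ [f [_ fadj _]].
apply/existsP; exists [ffun x => inord (f x %% s.+1)%N].
apply/forallP => x; apply/forallP => y; apply/implyP => /fadj.
rewrite /= /turan_adj !ffunE; apply: contraNneq => /(congr1 val) /=.
by rewrite !inordK ?ltn_pmod // => ->.
Qed.

Lemma turan_lt_cover_forcing (H : sgraph) (n s k : nat) :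
  (0 < n)%N -> (0 < s)%N -> ~~ colorable H s ->
  cover_forcing H n k -> (n < k + (n %/ s).+1)%N.
Proof.
case: n => // n _ s0 Hs force; rewrite ltnNge; apply: contra Hs => kn.
apply: (@turan_copy_colorable H n.+1 s ord0 s0); apply: force.
  by rewrite /= card_ord.
apply/min_degreeP => [|v].
  by rewrite /= card_ord; exact: leq_trans (leq_addr _ _) kn.
rewrite -(leq_add2r (n.+1 %/ s).+1); exact: leq_trans kn (turan_degree v).
Qed.

Theorem proposition6 (R : realType) (H : sgraph) (hH : has_edge H)
    (eta : R) (heta : 0 < eta) :
  exists n0 : nat, forall n : nat, (n0 <= n)%N ->
    ((1 - 1 / ((chromatic_number H)%:R - 1)) * n%:R - 1 : R) <= (delta' H n)%:R
      <= (1 - 1 / ((chromatic_number H)%:R - 1) + eta) * n%:R.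
Proof.
have [x0 [y0 xy0]] := hH.
rewrite /chromatic_number; case: ex_minnP => chi Hchi chi_min.
case: chi Hchi chi_min => [|[|s]] Hchi chi_min.
- by have /existsP[c _] := Hchi; case: (c x0).
- have /existsP[c /forallP/(_ x0)/forallP/(_ y0)] := Hchi.
  by rewrite xy0 !ord1 eqxx.
have notcol : ~~ colorable H s.+1 by apply/negP => /chi_min; lia.
have -> : (s.+2%:R - 1 : R) = s.+1%:R by rewrite -natr1 addrK.
set S : R := s.+1%:R; have S0 : 0 < S by rewrite ltr0n.
(* Of the slack [3 * n], two parts serve [cover_forcing_large] and the third absorbs the rounding
   error [q * S] of [m]. The bound [1 < q] settles the case [n <= m]. *)
have [q q2 hq] : exists2 q : nat, (1 < q)%N & 3 <= q%:R * eta.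
  exists (Num.truncn (3 / eta)).+2 => //; rewrite -ler_pdivrMr //.
  apply/ltW/(lt_trans (truncnS_gt _)).
  by rewrite ltr_nat.
have [|n0 hn0] := @cover_forcing_large H x0 s.+1 q _ Hchi; first lia.
exists (n0 + q * s.+1 + 1)%N => n hn.
rewrite /delta'; case: ex_minnP => k /asboolP kforce kmin.
have n_gt0 : (0 < n)%N by lia.
set c : R := 1 - 1 / S.
have cE : S * c = S - 1 by rewrite /c mulrBr mulr1 div1r mulfV ?gt_eqF.
have c0 : 0 <= c by rewrite -(pmulr_rge0 _ S0) cE subr_ge0 ler1n.
apply/andP; split.
  (* Multiplying by [S] replaces the floor of [n / S] by the bound [n]. *)
  have := turan_lt_cover_forcing n_gt0 (isT : (0 < s.+1)%N) notcol kforce.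
  rewrite addnS ltnS => /(leq_mul (leqnn s.+1)); rewrite mulnDr => kn.
  have : (s.+1 * n <= s.+1 * k + n)%N.
    by apply: leq_trans kn _; rewrite leq_add2l mulnC leq_trunc_div.
  rewrite -(ler_nat R) natrD !natrM -/S => Skn.
  have : c * n%:R <= k%:R; last by lra.
  by rewrite -(ler_pM2l S0) mulrA cE mulrBl mul1r lerBlDr.
have n0R : 0 <= n%:R :> R by rewrite ler0n.
have x_ge0 : 0 <= (c + eta) * n%:R by rewrite mulr_ge0 // addr_ge0 // ltW.
(* By minimality of [k], it suffices that the integer part [m] of the upper bound is forcing. *)
set m := Num.truncn ((c + eta) * n%:R).
have /andP[mx xm] : m%:R <= (c + eta) * n%:R < m.+1%:R by exact: truncn_itv.
apply: le_trans mx; rewrite ler_nat; apply: kmin; apply/asboolP.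
apply: hn0; first lia.
have [nm|mn] := leqP n m.
  by move: nm; rewrite -subn_eq0 => /eqP ->; rewrite !muln0 leq_mul2r q2 orbT.
rewrite -(ler_nat R) natrD !natrM natrB ?(ltnW mn) // -/S.
move: xm; rewrite -natr1 => xm.
have qS : q%:R * S <= n%:R by rewrite -natrM ler_nat; lia.
have Sm : S * (n%:R - m%:R) <= n%:R + S - S * eta * n%:R.
  by move/ltW: xm; rewrite -(ler_pM2l S0) mulrA mulrDr cE; lra.
have := ler_wpM2l (ler0n R q) Sm.
have S1 : 1 <= S by rewrite ler1n.
have : 3 * n%:R <= q%:R * (S * eta * n%:R).
  rewrite !mulrA ler_wpM2r // mulrAC -[leLHS]mulr1.
  by apply: ler_pM => //; lra.
lra.
Qed.
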